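(* Consider the discrete-time finite single-hop network with $N$ queues and utility-maximising service described in the context. Assume that each $\xi_i$ is a Bernoulli random variable with $\mathbb{E}(\xi_i)=\lambda_i$, $i=1,\dots,N$, and that there exists $\bar\nu\in\mathcal{C}$ such that $\lambda_i<\nu_i$ for all $i$. Then the Markov chain $\{\bar X(k),\ k=0,1,\ldots\}$ is positive recurrent.
   Context: Model. There are $N<\infty$ queues. The queue-length vector $\bar X(k)=(X_1(k),\dots,X_N(k))\in\mathbb{Z}_+^N$ evolves as $$X_i(k+1)=X_i(k)+\xi_i(k)-\eta_i(k),\qquad k=0,1,\dots$$ Here $\xi_i(k)$ is the number of arrivals to queue $i$ in slot $k$; the vectors $(\xi_i(k))_{i}$ are i.i.d. over $k$, dependence between different $i$ is arbitrary, $\mathbb{E}\,\xi_i(k)=\lambda_i$, and $\xi_i$ denotes a generic copy of $\xi_i(k)$. The variables $\eta_i(k)\in\{0,1\}$ are the service completions; given $\bar X(k)$ their conditional law depends only on $\bar X(k)$, and $(\xi_i(k))_i$ is independent of the past, of $\bar X(k)$ and of $(\eta_i(k))_i$. The process $\bar X(\cdot)$ is a Markov chain on a countable state space, assumed irreducible. Service rates. Let $\psi_i(\bar x)=\mathbb{E}(\eta_i(k)\mid \bar X(k)=\bar x)$. It is assumed that $\psi_i(\bar x)\in[0,1]$, that $\psi_i(\bar x)=0$ if $x_i=0$, and that for every $\bar x$ $$\bar\psi(\bar x)\in\arg\max_{\bar\mu\in\mathcal{C}}\ \sum_i g(x_i)h(\mu_i),$$ where $\mathcal{C}\subset\mathbb{R}_+^N$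 is compact and coordinate-convex (if $\bar\mu\in\mathcal{C}$ and $0\le\bar\mu^*\le\bar\mu$ coordinate-wise, then $\bar\mu^*\in\mathcal{C}$); $\mathcal{C}$ is not assumed convex. The convention $0\cdot(-\infty)=0$ is used. Condition on $h$: $h:[0,\infty)\to\mathbb{R}$ is strictly increasing, differentiable and concave, where both $\lim_{y\downarrow0}h(y)=h(0)>-\infty$ and $\lim_{y\downarrow 0}h(y)=-\infty$ (with $h(0)=-\infty$) are allowed. Condition on $g$: $g:\mathbb{Z}_+\to[0,\infty)$ is strictly increasing and $g(y)/\Delta(y)\to\infty$ as $y\to\infty$, where $\Delta(y)=g(y+1)-g(y)$ (equivalently $g(y+1)/g(y)\to1$).
   Formalization: The formal theorem additionally assumes g(y)→∞; as stated (g only strictly increasing with g(y)/Δ(y)→∞) g may be bounded, and then the claim fails, e.g. for two queues with h=log and a suitable non-convex C. *)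

(* Defs.v *)
From HB Require Import structures.
From mathcomp Require Import all_boot all_order all_algebra.
From mathcomp Require Import all_classical all_reals all_analysis.

Set Implicit Arguments.
Unset Strict Implicit.
Unset Printing Implicit Defensive.

Import Order.TTheory GRing.Theory Num.Theory.
Import numFieldNormedType.Exports.

Local Open Scope classical_set_scope.
Local Open Scope ring_scope.
Local Open Scope ereal_scope.

Section MarkovChain.
Variables (R : realType) (E : countType) (S : set E) (p : E -> E -> R).

Definition stochastic_matrix : Prop :=
  (forall x y, S x -> S y -> (0 <= p x y)%R) /\
  (forall x, S x -> \esum_(y in S) (p x y)%:E = 1).

(* The initial law is an arbitrary law on S. *)
Definition markov_chain (d : measure_display) (T : measurableType d)
    (P : probability T R) (X : nat -> T -> E) : Prop :=
  [/\ stochastic_matrix,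
      P [set w | S (X 0%N w)] = 1 &
      forall (k : nat) (x : nat -> E), (forall j, S (x j)) ->
        P [set w | forall j, (j <= k.+1)%N -> X j w = x j] =
        P [set w | forall j, (j <= k)%N -> X j w = x j] *
          (p (x k) (x k.+1))%:E].

Fixpoint nstep (n : nat) (x y : E) : \bar R :=
  if n is m.+1 then \esum_(z in S) ((p x z)%:E * nstep m z y)
  else ((x == y)%:R)%:E.

Definition irreducible : Prop :=
  forall x y, S x -> S y -> exists n : nat, 0 < nstep n x y.

(* [first_passage n x y] is the probability, starting from x, that the first
   visit to y at a time >= 1 takes place at time n.+1. *)
Fixpoint first_passage (n : nat) (x y : E) : \bar R :=
  if n is m.+1 then \esum_(z in S `\ y) ((p x z)%:E * first_passage m z y)
  else (p x y)%:E.

Definition recurrent_state (x : E) : Prop :=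
  \sum_(0 <= n <oo) first_passage n x x = 1.

Definition mean_return_time (x : E) : \bar R :=
  \sum_(0 <= n <oo) ((n.+1)%:R%:E * first_passage n x x).

Definition positive_recurrent : Prop :=
  forall x, S x -> recurrent_state x /\ mean_return_time x < +oo.

End MarkovChain.

Section UtilityMaximisation.
Variables (R : realType) (N : nat).

Definition service_region (C : set 'rV[R]_N) : Prop :=
  [/\ forall mu, C mu -> forall i, (0 <= mu ord0 i)%R,
      compact C &
      forall mu mu' : 'rV[R]_N, C mu ->
        (forall i, (0 <= mu' ord0 i <= mu ord0 i)%R) -> C mu'].

(* [h] stands for a function on [0, +oo[ which is real-valued, except that
   h 0 = -oo is allowed; its values at negative reals are irrelevant. *)
Definition utility_function (h : R -> \bar R) : Prop :=
  [/\ forall y : R, (0 < y)%R -> h y \is a fin_num,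
      forall x y : R, (0 <= x)%R -> (x < y)%R -> h x < h y,
      forall y : R, (0 < y)%R -> derivable (fine \o h : R -> R) y 1%R,
      forall x y t : R, (0 <= x)%R -> (0 <= y)%R -> (0 <= t <= 1)%R ->
        t%:E * h x + (1 - t)%:E * h y <= h (t * x + (1 - t) * y)%R &
      h y @[y --> (0%R : R)^'+] --> h 0%R].

(* This does not imply g n --> +oo: g may be bounded. *)
Definition weight_function (g : nat -> R) : Prop :=
  [/\ forall n, (0 <= g n)%R,
      forall m n, (m < n)%N -> (g m < g n)%R &
      (g n / (g n.+1 - g n))%R @[n --> \oo] --> +oo%R].

(* Here 0 * -oo = 0, by the definition of the product on \bar R. *)
Definition utility (g : nat -> R) (h : R -> \bar R)
    (x : {ffun 'I_N -> nat}) (mu : 'rV[R]_N) : \bar R :=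
  \sum_(i < N) ((g (x i))%:E * h (mu ord0 i)).

Definition is_argmax (C : set 'rV[R]_N) (f : 'rV[R]_N -> \bar R)
    (mu : 'rV[R]_N) : Prop :=
  C mu /\ forall mu', C mu' -> f mu' <= f mu.

End UtilityMaximisation.

Section Network.
Variables (d : measure_display) (T : measurableType d) (R : realType).
Variables (P : probability T R) (N : nat).

Definition vec (A : Type) (Y : 'I_N -> T -> A) (w : T) : {ffun 'I_N -> A} :=
  [ffun i => Y i w].

(* psi_i(x) = E(eta_i(k) | X(k) = x), where [Q x] is the probability mass
   function of the conditional law of the vector eta(k) given X(k) = x. *)
Definition service_rate
    (Q : {ffun 'I_N -> nat} -> {ffun 'I_N -> bool} -> R)
    (x : {ffun 'I_N -> nat}) : 'rV[R]_N :=
  (\row_(i < N) \sum_(s : {ffun 'I_N -> bool}) Q x s * (s i)%:R)%R.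

Variables (X xi : nat -> 'I_N -> {RV P >-> nat}).
Variables (eta : nat -> 'I_N -> {RV P >-> bool}).

(* The atoms of the (discrete) sigma-algebra generated by X(0), ..., X(k) and
   by xi(j), eta(j) for j < k. *)
Definition history (k : nat) (x a : nat -> {ffun 'I_N -> nat})
    (s : nat -> {ffun 'I_N -> bool}) : set T :=
  [set w | (forall j, (j <= k)%N -> vec (X j) w = x j) /\
           (forall j, (j < k)%N -> vec (xi j) w = a j /\
                                   vec (eta j) w = s j)].

(* Mutual independence of the vectors xi(k), k >= 0, is contained in
   [arrivals_indep], since the history at time k determines xi(j), j < k. *)
Record network (S : set {ffun 'I_N -> nat}) (lambda : 'rV[R]_N)
    (Q : {ffun 'I_N -> nat} -> {ffun 'I_N -> bool} -> R) : Prop := Network {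
  dynamics : forall k i,
    \forall w \ae P, (X k.+1 i w + eta k i w = X k i w + xi k i w)%N;
  arrivals_identically_distributed : forall k a,
    P [set w | vec (xi k) w = a] = P [set w | vec (xi 0%N) w = a];
  arrivals_mean : forall k i,
    'E_P[fun w => ((xi k i w)%:R : R)%R] = (lambda ord0 i)%:E;
  arrivals_indep : forall k x a s s' a',
    P (history k x a s `&` [set w | vec (eta k) w = s']
                       `&` [set w | vec (xi k) w = a']) =
    P (history k x a s `&` [set w | vec (eta k) w = s']) *
      P [set w | vec (xi k) w = a'];
  service_law : forall x, S x ->
    (forall s, (0 <= Q x s)%R) /\
    (\sum_(s : {ffun 'I_N -> bool}) Q x s = 1)%R;
  service_conditional_law : forall k x a s s', S (x k) ->
    P (history k x a s `&` [set w | vec (eta k) w = s']) =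
    P (history k x a s) * (Q (x k) s')%:E }.

Definition bernoulli_variable (Y : {RV P >-> nat}) : Prop :=
  P [set w | Y w = 0%N \/ Y w = 1%N] = 1.

End Network.

(* Main.v *)
(* By concavity, the derivatives c_i = h'(nu_i) > 0 exist and
   h(psi_i) <= h(nu_i) + c_i (psi_i - nu_i), so optimality of psi(x) against nu
   gives sum_i c_i g(x_i) (nu_i - psi_i) <= 0.  Take the Lyapunov function
   V(x) = sum_i c_i G(x_i) with G(n) = g(0) + ... + g(n - 1).  Since arrivals and
   services are 0 or 1 and g(n) - g(n - 1) = o(g(n)), the drift of V at x is at
   most K - sum_i c_i delta_i g(x_i), with delta_i = (nu_i - lambda_i) / 2, hence
   at most -1 outside a finite set because g tends to infinity.

   The passage from the drift to positive recurrence only uses the transition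
   matrix: to V one adds a combination of the truncated mean hitting times of a
   target state z, which makes the drift at most -1 everywhere off z; the
   resulting function bounds the mean hitting times of z. *)

Require Import Defs.
From HB Require Import structures.
From mathcomp Require Import all_boot all_order all_algebra.
From mathcomp Require Import all_classical all_reals all_analysis.
From mathcomp Require Import measurable_realfun.
From mathcomp Require Import lra ring.

Set Implicit Arguments.
Unset Strict Implicit.
Unset Printing Implicit Defensive.

Import Order.TTheory GRing.Theory Num.Theory.
Import numFieldNormedType.Exports.

Local Open Scope classical_set_scope.
Local Open Scope ring_scope.

(** * The Foster-Lyapunov criterion *)

Lemma le_esumZl (R : realType) (I : choiceType) (D : set I) (c : \bar R)
    (a : I -> \bar R) :
  (0 <= c)%E -> (forall i, D i -> 0 <= a i)%E ->
  (\esum_(i in D) (c * a i) <= c * \esum_(i in D) a i)%E.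
Proof.
move=> c0 a0; apply: ge_ereal_sup => _ [F [finF FD] <-].
rewrite !fsbig_finite//= big_seq -ge0_sume_distrr -?big_seq; last first.
  by move=> i; rewrite in_fset_set// inE => /FD/a0.
apply: lee_wpmul2l => //; apply: ereal_sup_ubound.
by exists F => //; rewrite fsbig_finite.
Qed.

Lemma esum_setD1 (R : realType) (I : choiceType) (D : set I) (z : I)
    (a : I -> \bar R) :
  D z -> (forall i, D i -> 0 <= a i)%E ->
  (\esum_(i in D) a i = a z + \esum_(i in D `\ z) a i)%E.
Proof.
move=> Dz a0; rewrite (esumID [set z])//; congr (_ + _)%E.
rewrite (_ : D `&` [set z] = [set z]) ?esum_set1//; first exact: a0.
by apply/seteqP; split => [x []//|x /= ->].
Qed.

Lemma gee_pMr1 (R : realType) (x y : \bar R) :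
  (0 <= x)%E -> (y <= 1)%E -> (x * y <= x)%E.
Proof. by move=> x0 y1; rewrite -[leRHS]mule1; exact: lee_wpmul2l. Qed.

(** * Hitting times of a fixed target state [z] *)

Section FosterLyapunov.
Variables (R : realType) (E : countType) (S : set E) (p : E -> E -> R) (z : E).
Hypotheses (hp : stochastic_matrix S p) (Sz : S z).

Let p_ge0 x y : S x -> S y -> 0 <= p x y.
Proof. by case: hp => h _; exact: h. Qed.

(* The probability, starting from x, of not visiting z at times 1, ..., n. *)
Fixpoint avoid (n : nat) (x : E) : \bar R :=
  if n is m.+1 then \esum_(y in S `\ z) ((p x y)%:E * avoid m y)%E else 1%E.

Lemma avoid_itv n x : S x -> (0 <= avoid n x <= 1)%E.
Proof.
elim: n x => [|n IH] x Sx /=; first by rewrite lee01 lexx.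
apply/andP; split.
  apply: esum_ge0 => y [Sy _]; apply: mule_ge0; first by rewrite lee_fin p_ge0.
  by case/andP: (IH _ Sy).
case: hp => _ /(_ _ Sx) <-; rewrite (esum_setD1 Sz); last first.
  by move=> y Sy; rewrite lee_fin p_ge0.
apply: (@le_trans _ _ (\esum_(y in S `\ z) (p x y)%:E)%E).
  apply: le_esum => y [Sy _]; apply: gee_pMr1 => //; first by rewrite lee_fin p_ge0.
  by case/andP: (IH _ Sy).
by rewrite leeDr// lee_fin p_ge0.
Qed.

Lemma avoid_ge0 n x : S x -> (0 <= avoid n x)%E.
Proof. by move=> /(avoid_itv n)/andP[]. Qed.

Lemma avoid_le1 n x : S x -> (avoid n x <= 1)%E.
Proof. by move=> /(avoid_itv n)/andP[]. Qed.

Lemma avoid_fin_num n x : S x -> avoid n x \is a fin_num.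
Proof.
by move=> Sx; rewrite ge0_fin_numE ?avoid_ge0// (le_lt_trans (avoid_le1 n Sx)) ?ltry.
Qed.

Lemma first_passage_ge0 n x : S x -> (0 <= first_passage S p n x z)%E.
Proof.
elim: n x => [|n IH] x Sx /=; first by rewrite lee_fin p_ge0.
by apply: esum_ge0 => y [Sy _]; rewrite mule_ge0 ?lee_fin ?p_ge0 ?IH.
Qed.

(** Not having visited [z] by time n splits by whether the step at time n+1 enters [z]; the case n =
    0 is total mass one. *)
Lemma first_passage_avoid n x :
  S x -> (first_passage S p n x z + avoid n.+1 x = avoid n x)%E.
Proof.
elim: n x => [|n IH] x Sx.
  case: hp => _ /(_ _ Sx) /=; rewrite (esum_setD1 Sz); last first.
    by move=> y Sy; rewrite lee_fin p_ge0.
  by move=> e; rewrite -[RHS]e; congr (_ + _)%E; apply: eq_esum => y _; rewrite mule1.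
rewrite [LHS]/= -esumD; last 2 first.
- by move=> y [Sy _]; rewrite mule_ge0 ?lee_fin ?p_ge0 ?first_passage_ge0.
- by move=> y [Sy _]; rewrite mule_ge0 ?lee_fin ?p_ge0// (avoid_ge0 n.+1).
apply: eq_esum => y [Sy _].
rewrite -ge0_muleDr ?first_passage_ge0 ?(avoid_ge0 n.+1)//.
by congr (_ * _)%E; exact: IH.
Qed.

Lemma nstep_itv n x : S x -> (0 <= nstep S p n x z <= 1)%E.
Proof.
elim: n x => [|n IH] x Sx /=; first by case: eqP; rewrite ?lee01 ?lexx.
apply/andP; split.
  apply: esum_ge0 => y Sy; apply: mule_ge0; first by rewrite lee_fin p_ge0.
  by case/andP: (IH _ Sy).
case: hp => _ /(_ _ Sx) <-; apply: le_esum => y Sy.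
apply: gee_pMr1 => //; first by rewrite lee_fin p_ge0.
by case/andP: (IH _ Sy).
Qed.

(** Being at [z] at time n and avoiding [z] up to time n are disjoint events; [x <> z] covers time
    0, which [avoid] does not look at. Irreducibility enters the drift argument through this
    bound. *)
Lemma nstep_avoid_le1 n x :
  S x -> x <> z -> (nstep S p n x z + avoid n x <= 1)%E.
Proof.
elim: n x => [|n IH] x Sx xz /=; first by case: eqP => // _; rewrite add0e.
have n0 y : S y -> (0 <= nstep S p n y z)%E.
  by move=> Sy; case/andP: (nstep_itv n Sy).
rewrite (esum_setD1 Sz); last first.
  by move=> y Sy; rewrite mule_ge0 ?lee_fin ?p_ge0 ?n0.
rewrite -addeA -esumD; last 2 first.
- by move=> y [Sy _]; rewrite mule_ge0 ?lee_fin ?p_ge0 ?n0.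
- by move=> y [Sy _]; rewrite mule_ge0 ?lee_fin ?p_ge0// avoid_ge0.
case: hp => _ /(_ _ Sx) <-.
rewrite [leRHS](esum_setD1 Sz); last by move=> y Sy; rewrite lee_fin p_ge0.
apply: leeD.
  apply: gee_pMr1 => //; first by rewrite lee_fin p_ge0.
  by case/andP: (nstep_itv n Sz).
apply: le_esum => y [Sy yz]; rewrite -ge0_muleDr ?n0 ?avoid_ge0//.
by apply: gee_pMr1 => //; rewrite ?lee_fin ?p_ge0//; exact: IH.
Qed.

(** The transition operator killed on entering [z]; [avoid n] is its n-th iterate applied to the
    constant 1. *)
Definition taboo (a : E -> \bar R) (x : E) : \bar R :=
  \esum_(y in S `\ z) ((p x y)%:E * a y)%E.

Lemma taboo_ge0 a x : (forall y, S y -> 0 <= a y)%E -> S x -> (0 <= taboo a x)%E.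
Proof.
by move=> a0 Sx; apply: esum_ge0 => y [Sy _]; rewrite mule_ge0 ?lee_fin ?p_ge0 ?a0.
Qed.

Lemma tabooD a b x : (forall y, S y -> 0 <= a y)%E ->
  (forall y, S y -> 0 <= b y)%E -> S x ->
  taboo (fun y => a y + b y)%E x = (taboo a x + taboo b x)%E.
Proof.
move=> a0 b0 Sx; rewrite /taboo -esumD; last 2 first.
- by move=> y [Sy _]; rewrite mule_ge0 ?lee_fin ?p_ge0 ?a0.
- by move=> y [Sy _]; rewrite mule_ge0 ?lee_fin ?p_ge0 ?b0.
by apply: eq_esum => y [Sy _]; rewrite ge0_muleDr ?a0 ?b0.
Qed.

Lemma le_taboo a b x : (forall y, S y -> y <> z -> a y <= b y)%E -> S x ->
  (taboo a x <= taboo b x)%E.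
Proof.
move=> ab Sx; apply: le_esum => y [Sy yz].
by apply: lee_wpmul2l; [rewrite lee_fin p_ge0|exact: ab].
Qed.

Lemma le_tabooZl (k : \bar R) a x : (0 <= k)%E -> (forall y, S y -> 0 <= a y)%E ->
  S x -> (taboo (fun y => k * a y)%E x <= k * taboo a x)%E.
Proof.
move=> k0 a0 Sx; rewrite /taboo; under eq_esum do rewrite muleCA.
by apply: le_esumZl => // y [Sy _]; rewrite mule_ge0 ?lee_fin ?p_ge0 ?a0.
Qed.

Lemma taboo_sum_avoid n x : S x ->
  taboo (fun y => \sum_(m < n) avoid m y)%E x = (\sum_(m < n) avoid m.+1 x)%E.
Proof.
move=> Sx; rewrite /taboo.
rewrite -(@esum_sum R E 'I_n (S `\ z) _ predT (fun y m => (p x y)%:E * avoid m y)%E).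
  apply: eq_esum => y [Sy _].
  by rewrite ge0_sume_distrr// => m _; exact: avoid_ge0.
by move=> y m [Sy _] _; rewrite mule_ge0 ?lee_fin ?p_ge0 ?avoid_ge0.
Qed.

(** Iterating the drift inequality shows that off [z] the function [W] dominates the truncated mean
    hitting time. The first step is split off because no drift is assumed at [z], where the bound
    will be used. *)
Lemma sum_avoid_le (W : E -> R) n x : (forall y, S y -> 0 <= W y) ->
  (forall y, S y -> y <> z -> taboo (fun y => (W y)%:E) y + 1 <= (W y)%:E)%E ->
  S x -> (\sum_(m < n) avoid m x <= 1 + taboo (fun y => (W y)%:E) x)%E.
Proof.
move=> W0 hW Sx; case: n => [|n].
  by rewrite big_ord0 adde_ge0// taboo_ge0// => y Sy; rewrite lee_fin W0.
rewrite big_ord_recl leeD2l// -taboo_sum_avoid//.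
elim: n x Sx => [|n IH] x Sx; apply: le_taboo => // y Sy yz.
  by rewrite big_ord0 lee_fin W0.
rewrite big_ord_recl/= (le_trans _ (hW y Sy yz))// addeC leeD2r//.
by rewrite -taboo_sum_avoid// IH.
Qed.

(* Adding K sum_(m < n) avoid m to the Lyapunov function W decreases the drift
   at x by K (1 - avoid n x), so that the exceptional states can be removed one
   at a time. *)
Lemma sum_avoid_bounded (l : seq E) (W : E -> R) (b : R) :
  irreducible S p -> 0 <= b -> (forall y, S y -> 0 <= W y) ->
  (forall y, S y -> y <> z ->
    taboo (fun y => (W y)%:E) y + 1 <= (W y + b * (y \in l)%:R)%:E)%E ->
  (taboo (fun y => (W y)%:E) z < +oo)%E ->
  exists B : R, forall n, (\sum_(m < n) avoid m z <= B%:E)%E.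
Proof.
move=> irr b0; elim: l W => [|x l IH] W W0 hW Wz.
  exists (fine (1 + taboo (fun y => (W y)%:E) z)%E) => n.
  have t0 : (0 <= taboo (fun y => (W y)%:E) z)%E.
    by apply: taboo_ge0 => // y Sy; rewrite lee_fin W0.
  rewrite fineK; last first.
    by rewrite ge0_fin_numE ?adde_ge0// lte_add_pinfty// ltry.
  apply: sum_avoid_le => // y Sy yz.
  by have := hW y Sy yz; rewrite in_nil mulr0 addr0.
(* The drift hypothesis never concerns a listed state that equals [z] or lies outside [S], so such a
   state is dropped. *)
have [[Sx xz]|Nx] := pselect (S x /\ x <> z); last first.
  apply: (IH W) => // y Sy yz; have := hW y Sy yz; rewrite in_cons.
  by case: eqP => // yx; case: Nx; rewrite -yx.
have [n nx] := irr x z Sx Sz.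
have {nx} unx : (avoid n x < 1)%E.
  rewrite -(add0e (avoid n x)) (lt_le_trans _ (nstep_avoid_le1 n Sx xz))//.
  by rewrite lteD2rE ?avoid_fin_num.
pose u m y := fine (avoid m y).
have uE m y : S y -> (u m y)%:E = avoid m y by move=> Sy; rewrite fineK ?avoid_fin_num.
have u0 m y : S y -> 0 <= u m y by move=> Sy; rewrite -lee_fin uE ?avoid_ge0.
have u1 m y : S y -> u m y <= 1 by move=> Sy; rewrite -lee_fin uE ?avoid_le1.
have {}unx : 0 < 1 - u n x by rewrite subr_gt0 -lte_fin uE.
(* The gain [K * (1 - u n x)] equals [b] and cancels the exceptional term at [x]; at other states
   the gain is nonnegative. *)
pose K := b / (1 - u n x).
have K0 : 0 <= K by rewrite divr_ge0 ?(ltW unx).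
pose W' y := W y + K * \sum_(m < n) u m y.
have W'le y : S y -> (taboo (fun y => (W' y)%:E) y <=
    taboo (fun y => (W y)%:E) y + (K * \sum_(m < n) u m.+1 y)%:E)%E.
  move=> Sy; rewrite /W'.
  under [X in taboo X]eq_fun do rewrite EFinD.
  rewrite tabooD//; last first.
    by move=> t St; rewrite lee_fin mulr_ge0// sumr_ge0// => m _; exact: u0.
  rewrite leeD2l//.
  under [X in taboo X]eq_fun do rewrite EFinM.
  apply: (le_trans (le_tabooZl _ _ Sy)); first by rewrite lee_fin.
    by move=> t St; rewrite lee_fin sumr_ge0// => m _; exact: u0.
  rewrite [leRHS]EFinM; apply: lee_wpmul2l; first by rewrite lee_fin.
  rewrite -sumEFin (eq_bigr (fun m : 'I_n => avoid m.+1 y)); last first.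
    by move=> m _; rewrite uE.
  rewrite -taboo_sum_avoid//; apply: le_taboo => // t St _.
  by rewrite -sumEFin; apply: lee_sum => m _; rewrite uE.
(* [taboo] shifts the index of [u] by one, so only the end terms [u 0 y = 1] and [u n y] differ. *)
have sumE y : \sum_(m < n) u m y = \sum_(m < n) u m.+1 y + (1 - u n y).
  have : \sum_(m < n.+1) u m y = 1 + \sum_(m < n) u m.+1 y by rewrite big_ord_recl.
  by rewrite big_ord_recr/=; lra.
apply: (IH W') => //.
- by move=> y Sy; rewrite addr_ge0 ?W0// mulr_ge0// sumr_ge0// => m _; exact: u0.
- move=> y Sy yz; apply: (le_trans (leeD2r 1 (W'le y Sy))).
  rewrite addeAC; apply: (le_trans (leeD2r _ (hW y Sy yz))).
  rewrite -EFinD lee_fin /W' sumE mulrDr in_cons.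
  suff : b * ((y == x) || (y \in l))%:R <= b * (y \in l)%:R + K * (1 - u n y) by lra.
  have [->|_] /= := eqVneq y x.
    rewrite /K divfK ?gt_eqF// mulr1.
    by rewrite lerDr mulr_ge0.
  by rewrite lerDl mulr_ge0// subr_ge0 u1.
- by rewrite (le_lt_trans (W'le z Sz))// lte_add_pinfty// ltry.
Qed.

(** * From bounded truncated return times to positive recurrence *)

Lemma sum_first_passage n :
  (\sum_(m < n) first_passage S p m z z + avoid n z = 1)%E.
Proof.
elim: n => [|n IH]; first by rewrite big_ord0 add0e.
by rewrite big_ord_recr/= -addeA first_passage_avoid.
Qed.

(** Both sides are the mean of the return time truncated at n: by its values on the left, the value
    m+1 having probability [first_passage m], and by its tails on the right. *)
Lemma sum_return_time n :
  (\sum_(m < n) (m.+1%:R%:E * first_passage S p m z z) + n%:R%:E * avoid n z =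
   \sum_(m < n) avoid m z)%E.
Proof.
elim: n => [|n IH]; first by rewrite !big_ord0 add0e mul0e.
rewrite !big_ord_recr/= -IH -addeA -ge0_muleDr ?first_passage_ge0//; last first.
  exact: (avoid_ge0 n.+1).
rewrite -/(avoid n.+1 z) first_passage_avoid// -addeA; congr (_ + _)%E.
by rewrite -[in LHS]natr1 EFinD ge0_muleDl ?lee_fin// mul1e.
Qed.

(** The mean is bounded by dropping the nonnegative boundary term of [sum_return_time]. If return
    had probability s < 1, every [avoid n z] would be at least 1 - s and the sums would be
    unbounded. *)
Lemma bounded_sum_avoid_recurrent (B : R) :
  (forall n, \sum_(m < n) avoid m z <= B%:E)%E ->
  recurrent_state S p z /\ (mean_return_time S p z < +oo)%E.
Proof.
move=> hB; split; last first.
  rewrite /mean_return_time (@le_lt_trans _ _ B%:E) ?ltry//.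
  apply: lime_le.
    by apply: is_cvg_nneseries => n _ _; rewrite mule_ge0// first_passage_ge0.
  apply: nearW => n; rewrite big_mkord (le_trans _ (hB n))// -sum_return_time.
  by rewrite leeDl// mule_ge0// avoid_ge0.
rewrite /recurrent_state.
have f0 n : (0 <= n)%N -> true -> (0 <= first_passage S p n z z)%E.
  by move=> _ _; exact: first_passage_ge0.
set s := (\sum_(0 <= n <oo) _)%E.
have s1 : (s <= 1)%E.
  apply: lime_le; first exact: is_cvg_nneseries.
  by apply: nearW => n; rewrite big_mkord -(sum_first_passage n) leeDl// avoid_ge0.
have s0 : (0 <= s)%E by apply: nneseries_ge0.
have sfin : s \is a fin_num by rewrite ge0_fin_numE// (le_lt_trans s1)// ltry.
apply/eqP; rewrite eq_le s1 -(fineK sfin) lee_fin leNgt; apply/negP => slt.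
have us n : ((1 - fine s)%:E <= avoid n z)%E.
  rewrite EFinB fineK// leeBlDl// -{1}(sum_first_passage n) leeD2r//.
  rewrite -(big_mkord xpredT (fun m => first_passage S p m z z)).
  exact: nneseries_lim_ge.
have := hB (Num.truncn (B / (1 - fine s))).+1.
apply/negP; rewrite -ltNge.
apply: (@lt_le_trans _ _
    (\sum_(m < (Num.truncn (B / (1 - fine s))).+1) (1 - fine s)%:E)%E); last first.
  by apply: lee_sum => m _.
rewrite sumEFin lte_fin sumr_const card_ord -mulr_natl.
by rewrite -ltr_pdivrMr ?subr_gt0// truncnS_gt.
Qed.

End FosterLyapunov.

(** The drift bound passes to the killed operator for any target [z], since the omitted term at [z]
    is nonnegative; at [z] itself it yields the finiteness asked by [sum_avoid_bounded]. *)
Lemma foster_lyapunov (R : realType) (E : countType) (S : set E)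
    (p : E -> E -> R) (V : E -> R) (b : R) (l : seq E) :
  stochastic_matrix S p -> irreducible S p -> 0 <= b ->
  (forall x, S x -> 0 <= V x) ->
  (forall x, S x ->
    \esum_(y in S) (p x y * V y)%:E + 1 <= (V x + b * (x \in l)%:R)%:E)%E ->
  positive_recurrent S p.
Proof.
move=> hp irr b0 V0 hV z Sz.
have le_t x : S x -> (taboo S p z (fun y => (V y)%:E) x <=
    \esum_(y in S) (p x y * V y)%:E)%E.
  move=> Sx; rewrite (esum_setD1 Sz).
    by rewrite leeDr// lee_fin mulr_ge0 ?V0//; case: hp => + _; exact.
  by move=> y Sy; rewrite lee_fin mulr_ge0 ?V0//; case: hp => + _; exact.
have [B hB] : exists B : R, forall n, (\sum_(m < n) avoid S p z m z <= B%:E)%E.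
  apply: (@sum_avoid_bounded _ _ _ _ _ hp Sz l V b) => //.
    by move=> x Sx _; rewrite (le_trans _ (hV x Sx))// leeD2r ?le_t.
  rewrite (le_lt_trans (le_t _ Sz))//.
  rewrite (le_lt_trans _ (le_lt_trans (hV z Sz) (ltry _)))// leeDl//.
exact: bounded_sum_avoid_recurrent hB.
Qed.

(** * Countably valued random variables *)

Section CountablyValued.
Variables (d : measure_display) (T : measurableType d) (R : realType).
Variables (mu : {measure set T -> \bar R}) (I : countType) (f : T -> I).
Hypothesis mf : forall v, measurable [set w | f w = v].

(** Coding values by [pickle] turns countable additivity over [I] into a series over the naturals;
    codes of no attained value have empty fibers. *)
Lemma pickle_fiber n : [set w | pickle (f w) = n] = set0 \/
  exists v, [set w | pickle (f w) = n] = [set w | f w = v].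
Proof.
have [[w <-]|nf] := pselect (exists w, pickle (f w) = n); [right|left].
  exists (f w); apply/seteqP; split => [w' /= /(pcan_inj pickleK)//|w' /= ->//].
by apply/seteqP; split => // w /= fw; apply: nf; exists w.
Qed.

Lemma measurable_pickle n : measurable [set w | pickle (f w) = n].
Proof.
by have [->|[v ->]] := pickle_fiber n.
Qed.

Lemma measurable_countably_valued (D : set I) : measurable [set w | D (f w)].
Proof.
rewrite (_ : [set _ | _] = \bigcup_(v : I) ([set w | f w = v] `&` [set w | D v])).
  apply: countable_bigcupT_measurable => [|v]; first exact: countableP.
  apply: measurableI => //.
  have [Dv|Dv] := pselect (D v).
    by rewrite (_ : [set _ | _] = setT)//; apply/seteqP; split.
  by rewrite (_ : [set _ | _] = set0)//; apply/seteqP; split.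
by apply/seteqP; split => [w Dw|w [v _ []/= <-]//]; exists (f w).
Qed.

Lemma measure_pickle_partition (A : set T) : measurable A ->
  (mu A = \sum_(0 <= n <oo) mu (A `&` [set w | pickle (f w) = n]))%E.
Proof.
move=> mA; rewrite -[LHS](_ : mu (\bigcup_n (A `&` [set w | pickle (f w) = n])) = _).
  rewrite measure_bigcup//=.
  - by apply: eq_eseriesl => n; rewrite in_setT.
  - by move=> n _; apply: measurableI => //; exact: measurable_pickle.
  - by move=> m n _ _ [w [[_ <-] [_ <-]]].
congr (mu _); apply/seteqP; split => [w [n _ []]//|w Aw].
by exists (pickle (f w)).
Qed.

Lemma measure_gt0_fiber (A : set T) : measurable A -> (0 < mu A)%E ->
  exists v, (0 < mu (A `&` [set w | f w = v]))%E.
Proof.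
move=> mA A0; apply: contrapT => nA.
move: A0; rewrite measure_pickle_partition// eseries0 ?ltxx// => n _ _.
apply/eqP; rewrite -measure_le0.
have [->|[v ->]] := pickle_fiber n; first by rewrite setI0 measure0.
by rewrite leNgt; apply/negP => h; apply: nA; exists v.
Qed.

(** Summing over the countably many values of [f] removes the conditioning on [f], which will be the
    past arrivals and services. *)
Lemma measure_fiberwise_product (A B : set T) (c : R) : 0 <= c ->
  measurable A -> measurable B ->
  (forall v, mu (A `&` [set w | f w = v] `&` B) =
             mu (A `&` [set w | f w = v]) * c%:E)%E ->
  (mu (A `&` B) = mu A * c%:E)%E.
Proof.
move=> c0 mA mB hv; rewrite measure_pickle_partition; last exact: measurableI.
rewrite [in RHS]measure_pickle_partition// muleC -nneseriesZl; last first.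
  by move=> n _; exact: measure_ge0.
apply: eq_eseriesr => n _; rewrite setIAC.
have [->|[v ->]] := pickle_fiber n; last by rewrite hv muleC.
by rewrite setI0 set0I measure0 mule0.
Qed.

End CountablyValued.

(** * Measurability of vector events and integrals of simple functions *)

Lemma measurable_forall (d : measure_display) (T : measurableType d)
    (I : countType) (D : pred I) (F : I -> set T) :
  (forall i, measurable (F i)) -> measurable [set w | forall i, D i -> F i w].
Proof.
move=> mF.
rewrite (_ : [set _ | _] = ~` \bigcup_(i : I) (if D i then ~` F i else set0)).
  apply: measurableC; apply: countable_bigcupT_measurable => // i.
  by case: ifP => // _; exact: measurableC.
apply/seteqP; split => [w Fw [i _]|w nF i Di].
  by case: ifP => // Di /(_ (Fw i Di)).
by apply: contrapT => Fi; apply: nF; exists i => //; rewrite Di.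
Qed.

Lemma measurable_vec (d : measure_display) (T : measurableType d)
    (N : nat) (d' : measure_display) (A : measurableType d')
    (Y : 'I_N -> {mfun T >-> A}) (v : {ffun 'I_N -> A}) :
  (forall a : A, measurable [set a]) -> measurable [set w | vec Y w = v].
Proof.
move=> mA; rewrite (_ : [set _ | _] =
    [set w | forall i, true -> (Y i @^-1` [set v i]) w]).
  apply: measurable_forall => i.
  by rewrite -[X in measurable X]setTI; exact: (measurable_funP (Y i)).
apply/seteqP; split => w /=; first by move=> <- i _; rewrite ffunE.
by move=> Yv; apply/ffunP => i; rewrite ffunE Yv.
Qed.

Lemma ae_integral_simple (d : measure_display) (T : measurableType d)
    (R : realType) (mu : {measure set T -> \bar R}) (I : finType)
    (A : I -> set T) (c : I -> R) (f : T -> R) :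
  (forall i, measurable (A i)) -> (forall i, 0 <= c i) ->
  measurable_fun setT f -> (forall w, 0 <= f w) ->
  (\forall w \ae mu, f w = \sum_i c i * \1_(A i) w) ->
  (\int[mu]_w (f w)%:E = \sum_i (c i)%:E * mu (A i))%E.
Proof.
move=> mA c0 mf f0 fE.
pose F i (w : T) : R := c i * \1_(A i) w.
have mF i : measurable_fun [set: T] (fun w => (F i w)%:E).
  by apply/measurable_EFinP; apply: measurable_funM.
have F0 i w : (0 <= (F i w)%:E)%E by rewrite lee_fin mulr_ge0.
rewrite (@ge0_ae_eq_integral _ _ _ mu setT _
  (fun w => (\sum_(i <- index_enum I) (F i w)%:E)%E))//.
- rewrite ge0_integral_sum//; apply: eq_bigr => i _.
  rewrite (@integralZl_indic _ _ _ _ _ measurableT (fun=> A i))//.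
    by rewrite integral_indic// setIT.
  by rewrite ltNge c0.
- exact/measurable_EFinP.
- exact: emeasurable_sum.
- by move=> w _; rewrite lee_fin.
- by move=> w _; exact: sume_ge0.
- by apply: filterS fE => w -> _; rewrite sumEFin.
Qed.

(** * The transition matrix of the network *)

Lemma measure_bigsetU_le (d : measure_display) (T : measurableType d)
    (R : realType) (mu : {measure set T -> \bar R}) (I : Type) (r : seq I)
    (D : pred I) (A : I -> set T) : (forall i, measurable (A i)) ->
  (mu (\big[setU/set0]_(i <- r | D i) A i) <= \sum_(i <- r | D i) mu (A i))%E.
Proof.
move=> mA; elim: r => [|i r IH]; first by rewrite !big_nil measure0.
rewrite !big_cons; case: ifP => // _.
apply: le_trans (leeD2l _ IH); apply: measureU2 => //.
exact: bigsetU_measurable.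
Qed.

Lemma probability1_ae (d : measure_display) (T : measurableType d)
    (R : realType) (P : probability T R) (A : set T) :
  measurable A -> P A = 1%E -> \forall w \ae P, A w.
Proof.
move=> mA A1; exists (~` A); split => //; first exact: measurableC.
by rewrite [LHS]probability_setC// A1 subee.
Qed.

Section NetworkTransitions.
Variables (d : measure_display) (T : measurableType d) (R : realType).
Variables (P : probability T R) (N : nat).
Variables (X xi : nat -> 'I_N -> {RV P >-> nat}).
Variables (eta : nat -> 'I_N -> {RV P >-> bool}).
Variables (S : set {ffun 'I_N -> nat}) (lambda : 'rV[R]_N).
Variables (Q : {ffun 'I_N -> nat} -> {ffun 'I_N -> bool} -> R).
Variables (p : {ffun 'I_N -> nat} -> {ffun 'I_N -> nat} -> R).
Hypothesis model : network X xi eta S lambda Q.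
Hypothesis chain : markov_chain S p P (fun k => vec (X k)).
Hypothesis irr : irreducible S p.
Hypothesis bern : forall k i, bernoulli_variable (xi k i).

Local Notation state := {ffun 'I_N -> nat}.
Local Notation bits := {ffun 'I_N -> bool}.

(** Under Bernoulli arrivals these vectors carry all the mass; a finite index type makes
    expectations finite sums. *)
Definition of_bits (a : bits) : state := [ffun i => nat_of_bool (a i)].

(** Subtraction of naturals truncates at 0, but it is exact wherever the dynamics holds. *)
Definition next_state (x : state) (a s : bits) : state :=
  [ffun i => (x i + a i - s i)%N].

Definition arrival_pmf (a : bits) : R :=
  fine (P [set w | vec (xi 0%N) w = of_bits a]).

Definition state_path (k : nat) (x : nat -> state) : set T :=
  [set w | forall j, (j <= k)%N -> vec (X j) w = x j].

Lemma measurable_X k x : measurable [set w | vec (X k) w = x].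
Proof. exact: measurable_vec. Qed.

Lemma measurable_xi k x : measurable [set w | vec (xi k) w = x].
Proof. exact: measurable_vec. Qed.

Lemma measurable_eta k s : measurable [set w | vec (eta k) w = s].
Proof. exact: measurable_vec. Qed.

Lemma measurable_path k x : measurable (state_path k x).
Proof.
exact: (@measurable_forall _ _ nat (fun j => (j <= k)%N)
  (fun j => [set w | vec (X j) w = x j]) (fun j => measurable_X j (x j))).
Qed.

Lemma arrival_pmfE a :
  P [set w | vec (xi 0%N) w = of_bits a] = (arrival_pmf a)%:E.
Proof. by rewrite fineK// fin_num_measure//; exact: measurable_xi. Qed.

Lemma arrival_pmf_ge0 a : 0 <= arrival_pmf a.
Proof. by rewrite fine_ge0// measure_ge0. Qed.

(* The model prescribes these probabilities given the whole history; sum over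
   the possible past arrivals and services. *)
Lemma path_service_arrival k x s a : S (x k) ->
  (P (state_path k x `&` ([set w | vec (eta k) w = s] `&`
                    [set w | vec (xi k) w = of_bits a])) =
   P (state_path k x) * (Q (x k) s * arrival_pmf a)%:E)%E.
Proof.
move=> Sx.
(* The fibers of [f] over lists of length [k] cut [state_path] into the histories of the model; the
   other fibers are empty. *)
pose f w := mkseq (fun j => (vec (xi j) w, vec (eta j) w)) k.
have fE v w : size v = k -> f w = v <-> forall j, (j < k)%N ->
    vec (xi j) w = (nth ([ffun=> 0%N], [ffun=> false]) v j).1 /\
    vec (eta j) w = (nth ([ffun=> 0%N], [ffun=> false]) v j).2.
  move=> vk; split=> [<- j jk|h]; first by rewrite nth_mkseq.
  apply: (@eq_from_nth _ ([ffun=> 0%N], [ffun=> false])).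
    by rewrite size_mkseq vk.
  move=> j; rewrite size_mkseq => jk; rewrite nth_mkseq//.
  by have [-> ->] := h j jk; case: nth.
have fN v : size v <> k -> [set w | f w = v] = set0.
  move=> vk; apply/seteqP; split => // w /= fw; apply: vk.
  by rewrite -fw size_mkseq.
apply: (@measure_fiberwise_product _ _ _ P _ f).
- move=> v; have [vk|/eqP/fN ->] := eqVneq (size v) k; last exact: measurable0.
  rewrite (_ : [set _ | _] = [set w | forall j, (j < k)%N ->
    ([set w | vec (xi j) w = (nth ([ffun=> 0%N], [ffun=> false]) v j).1] `&`
     [set w | vec (eta j) w = (nth ([ffun=> 0%N], [ffun=> false]) v j).2]) w]).
    apply: measurable_forall => j; apply: measurableI.
      exact: measurable_xi.
    exact: measurable_eta.
  by apply/seteqP; split => w /=; rewrite fE.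
- rewrite mulr_ge0 ?arrival_pmf_ge0//.
  by have [/(_ s)] := service_law model Sx.
- exact: measurable_path.
- by apply: measurableI; [exact: measurable_eta|exact: measurable_xi].
move=> v; have [vk|/eqP/fN ->] := eqVneq (size v) k; last first.
  by rewrite setI0 set0I measure0 mul0e.
rewrite (_ : state_path k x `&` _ = history X xi eta k x
    (fun j => (nth ([ffun=> 0%N], [ffun=> false]) v j).1)
    (fun j => (nth ([ffun=> 0%N], [ffun=> false]) v j).2)); last first.
  by apply/seteqP; split => w [] /= h1; rewrite fE.
rewrite setIA; apply: (etrans (arrivals_indep model _ _ _ _ _ _)).
rewrite (service_conditional_law model)//.
by rewrite (arrivals_identically_distributed model) arrival_pmfE EFinM muleA.
Qed.

(** The model constrains [p y] only through paths of positive probability, so each state must be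
    shown to be visited. Some initial state has positive mass, and its path is extended by one
    positive transition at a time. *)
Lemma reachable y : S y -> exists k x,
  [/\ forall j, S (x j), x k = y & (0 < P (state_path k x))%E].
Proof.
case: chain => _ X0 step Sy.
suff : forall n k x, (forall j, S (x j)) -> (0 < P (state_path k x))%E ->
    (0 < nstep S p n (x k) y)%E -> exists k x,
  [/\ forall j, S (x j), x k = y & (0 < P (state_path k x))%E].
  have : (0 < P [set w | S (vec (X 0%N) w)])%E by rewrite X0 lte01.
  have mX0 := @measurable_countably_valued _ _ _ _ (measurable_X 0).
  move=> /(measure_gt0_fiber (measurable_X 0%N) (mX0 S))[v].
  set A := _ `&` _ => A0 main.
  have Sv : S v.
    apply: contrapT => Sv; move: A0; rewrite (_ : A = set0) ?measure0 ?ltxx//.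
    by apply/seteqP; split => // w [/= + Xv]; rewrite Xv.
  have [n] := irr Sv Sy.
  apply: (main n 0%N (fun=> v)) => //.
  apply: (lt_le_trans A0); apply: le_measure; rewrite ?inE.
  - by apply: measurableI; [exact: mX0|exact: measurable_X].
  - exact: measurable_path.
  - by move=> w [_ /= Xv] j; rewrite leqn0 => /eqP ->.
elim=> [|n IH] k x Sx px /=.
  by case: eqP => [xy _|_]; [exists k, x|rewrite ltxx].
move=> h.
have [z [Sz pz nz]] : exists z, [/\ S z, 0 < p (x k) z & (0 < nstep S p n z y)%E].
  apply: contrapT => nz; move: h; rewrite esum1 ?ltxx// => z Sz.
  have hp : stochastic_matrix S p by case: chain.
  have := hp.1 _ _ (Sx k) Sz; rewrite le_eqVlt => /orP[/eqP <-|pz].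
    by rewrite mul0e.
  have /andP[nz0 _] := nstep_itv y hp n Sz.
  move: nz0; rewrite le_eqVlt => /orP[/eqP <-|nz0]; first by rewrite mule0.
  by case: nz; exists z.
(* The path moves to [z] at time k+1; its later values only have to lie in [S]. *)
pose x' j := if (j <= k)%N then x j else z.
have x'k1 : x' k.+1 = z by rewrite /x' ltnn.
have x'k : x' k = x k by rewrite /x' leqnn.
have Sx' j : S (x' j) by rewrite /x'; case: ifP.
apply: (IH k.+1 x') => //; last by rewrite x'k1.
have : (0 < P (state_path k x) * (p (x k) z)%:E)%E by rewrite mule_gt0.
rewrite /state_path step// x'k x'k1.
by congr (_ < P _ * _)%E; apply/seteqP; split => w /= + j jk => /(_ j jk) ->;
  rewrite /x' jk.
Qed.

(** * Almost sure binary arrivals and the bound on the transition matrix *)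

Lemma arrivals_bits k : \forall w \ae P, forall i, (xi k i w <= 1)%N.
Proof.
apply: filter_forall => i.
have mA : measurable [set w | xi k i w = 0%N \/ xi k i w = 1%N].
  rewrite (_ : [set _ | _] = xi k i @^-1` [set n | n = 0%N \/ n = 1%N])//.
  by rewrite -[X in measurable X]setTI; exact: (measurable_funP (xi k i)).
by apply: filterS (probability1_ae mA (bern k i)) => w /= [] ->.
Qed.

Lemma of_bitsP (x : state) : (forall i, (x i <= 1)%N) -> exists a, x = of_bits a.
Proof.
move=> x1; exists [ffun i => x i == 1%N]; apply/ffunP => i; rewrite !ffunE.
by case: (x i) (x1 i) => [|[|]].
Qed.

Lemma of_bits_inj : injective of_bits.
Proof.
move=> a b /ffunP ab; apply/ffunP => i; have := ab i; rewrite !ffunE.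
by case: (a i) (b i) => [] [].
Qed.

(** After multiplication by the positive probability of a path ending at [x], a step to [y] forces,
    outside a null set, a pair (a, s) with [next_state x a s = y]; a union bound concludes. An upper
    bound suffices against a nonnegative Lyapunov function. *)
Lemma transition_le x y : S x -> S y ->
  p x y <= \sum_(a : bits) \sum_(s : bits)
             (y == next_state x a s)%:R * (Q x s * arrival_pmf a).
Proof.
move=> Sx Sy; have [k [xs [Sxs <- p0]]] := reachable Sx.
have pfin : P (state_path k xs) \is a fin_num.
  by rewrite fin_num_measure//; exact: measurable_path.
pose q := fine (P (state_path k xs)).
have q0 : 0 < q by rewrite -lte_fin fineK.
rewrite -(ler_pM2l q0) -lee_fin EFinM fineK//.
pose x' j := if (j <= k)%N then xs j else y.
have x'k1 : x' k.+1 = y by rewrite /x' ltnn.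
have x'k : x' k = xs k by rewrite /x' leqnn.
have Sx' j : S (x' j) by rewrite /x'; case: ifP.
have pathE : state_path k x' = state_path k xs.
  by apply/seteqP; split => w /= + j jk => /(_ j jk) ->; rewrite /x' jk.
have [_ _ /(_ k x' Sx')] := chain.
rewrite x'k x'k1 -/(state_path k x') -/(state_path k.+1 x') pathE => <-.
have dyn : \forall w \ae P, (forall i, X k.+1 i w + eta k i w = X k i w + xi k i w)%N /\
    (forall i, (xi k i w <= 1)%N).
  have dynk : \forall w \ae P,
      forall i, (X k.+1 i w + eta k i w = X k i w + xi k i w)%N.
    by apply: filter_forall => i; exact: (dynamics model k i).
  by apply: filterI dynk _; exact: arrivals_bits.
have [M [mM M0 subM]] := dyn.
pose B (as_ : bits * bits) := state_path k xs `&`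
  ([set w | vec (eta k) w = as_.2] `&` [set w | vec (xi k) w = of_bits as_.1]).
have mB as_ : measurable (B as_).
  apply: measurableI; first exact: measurable_path.
  by apply: measurableI; [exact: measurable_eta|exact: measurable_xi].
apply: (@le_trans _ _ (P (M `|` \big[setU/set0]_(as_ |
    y == next_state (xs k) as_.1 as_.2) B as_))).
  apply: le_measure; rewrite ?inE.
  - exact: measurable_path.
  - by apply: measurableU => //; exact: bigsetU_measurable.
  move=> w pw; have [Mw|Mw] := pselect (M w); [by left|right].
  have [dw xw] : (forall i, X k.+1 i w + eta k i w = X k i w + xi k i w)%N /\
      (forall i, (xi k i w <= 1)%N).
    by apply: contrapT => nw; apply: Mw; exact: subM.
  have [a aE] : exists a, vec (xi k) w = of_bits a.
    by apply: of_bitsP => i; rewrite ffunE.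
  pose s := vec (eta k) w.
  have pkw : state_path k xs w.
    by rewrite -pathE => j jk; apply: pw; rewrite ltnW.
  rewrite -bigcup_seq_cond; exists (a, s); last by [].
  rewrite /= mem_index_enum/=; apply/eqP/ffunP => i; rewrite !ffunE.
  have /ffunP/(_ i) := aE; rewrite !ffunE => <-.
  have /ffunP/(_ i) := pw k.+1 (leqnn _); rewrite x'k1 ffunE => <-.
  have /ffunP/(_ i) := pkw k (leqnn _); rewrite ffunE => <-.
  by rewrite -dw addnK.
apply: (le_trans (measureU2 _ _ _)) => //; first exact: bigsetU_measurable.
rewrite [X in (X + _)%E]M0 add0e; apply: (le_trans (measure_bigsetU_le _ _ _ mB)).
rewrite pair_big/= mulr_sumr -sumEFin big_mkcond/=; apply: lee_sum => -[a s] _ /=.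
case: eqP => _; last by rewrite mul0r mulr0.
rewrite mul1r [leRHS]EFinM fineK// le_eqVlt.
by rewrite [X in X == _](path_service_arrival _ _ (Sxs k)) eqxx.
Qed.

Lemma integral_arrival (c : bits -> R) (f : state -> R) :
  (forall a, 0 <= c a) -> (forall x, 0 <= f x) ->
  (forall a, f (of_bits a) = c a) ->
  (\int[P]_w (f (vec (xi 0%N) w))%:E = (\sum_a arrival_pmf a * c a)%:E)%E.
Proof.
move=> c0 f0 fc.
rewrite (@ae_integral_simple _ _ _ P _
  (fun a => [set w | vec (xi 0%N) w = of_bits a]) c)//.
- rewrite -sumEFin; apply: eq_bigr => a _.
  by rewrite EFinM muleC; congr (_ * _)%E; exact: (arrival_pmfE a).
- by move=> a; exact: measurable_xi.
- move=> _ Y mY; rewrite setTI.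
  exact: (@measurable_countably_valued _ _ _ _ (measurable_xi 0) [set x | Y (f x)]).
- apply: filterS (arrivals_bits 0%N) => w xw.
  have [a aE] : exists a, vec (xi 0%N) w = of_bits a.
    by apply: of_bitsP => i; rewrite ffunE.
  rewrite (bigD1 a)//= big1 ?addr0 => [|b ba].
    by rewrite aE fc indicE mem_set//= mulr1.
  rewrite indicE memNset ?mulr0//= aE => /of_bits_inj ab.
  by rewrite ab eqxx in ba.
Qed.

Lemma sum_arrival_pmf : \sum_a arrival_pmf a = 1.
Proof.
apply/EFin_inj; under eq_bigr do rewrite -[arrival_pmf _]mulr1.
rewrite -(@integral_arrival (cst 1) (cst 1))//.
apply: (etrans (integral_cst P measurableT 1)); rewrite mul1e.
exact: probability_setT.
Qed.

Lemma arrival_pmf_mean i : \sum_a arrival_pmf a * (a i)%:R = lambda ord0 i.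
Proof.
have fc (a : bits) : (of_bits a i)%:R = (a i)%:R :> R by rewrite ffunE.
have := @integral_arrival (fun a => (a i)%:R) (fun x => (x i)%:R)
  (fun a => ler0n _ _) (fun x => ler0n _ _) fc.
have := arrivals_mean model 0%N i; rewrite unlock => EX intX.
by apply/EFin_inj; rewrite -EX -intX; apply: eq_integral => w _; rewrite ffunE.
Qed.

End NetworkTransitions.

(** * The drift of the Lyapunov function *)

Lemma utility_supergradient (R : realType) (h : R -> \bar R) (v : R) :
  utility_function h -> 0 < v ->
  exists2 c : R, 0 < c &
    forall y, 0 <= y -> (h y <= (fine (h v) + c * (y - v))%:E)%E.
Proof.
move=> [hfin hincr hder hconc _] v0.
pose H := fine \o h.
have hH y : 0 < y -> h y = (H y)%:E by move=> y0; rewrite fineK ?hfin.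
have dH : differentiable H v by apply/derivable1_diffP; exact: hder.
have le_h y : 0 <= y -> (h y <= (H v + 'D_1 H v * (y - v))%:E)%E.
  move=> y0.
  have hy : (h y < +oo)%E.
    by apply: lt_le_trans (hincr y (y + 1) y0 _) (leey _); rewrite ltrDl.
  case hyE : (h y) hy => [r| |]//; last by rewrite leNye.
  move=> _; rewrite lee_fin -lerBlDl.
  (* The slope along [y - v] is the right limit of difference quotients in t; by concavity each one
     with 0 < t < 1 is at least h(y) - h(v). *)
  have -> : 'D_1 H v * (y - v) = 'D_(y - v) H v.
    rewrite !deriveE//.
    have -> : 'd H v (y - v) = (y - v) *: 'd H v 1.
      by rewrite -linearZ; congr ('d H v _); rewrite /GRing.scale/= mulr1.
    by rewrite mulrC.
  have Dlim : (fun t : R => t^-1 *: (H (t *: (y - v) + v) - H v)) @ (0:R)^'+ -->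
      'D_(y - v) H v.
    apply: cvg_dnbhs_at_right.
    by have : derivable H v (y - v) by exact: diff_derivable.
  rewrite -(cvg_lim _ Dlim)//; apply: limr_ge.
    by apply/cvg_ex; exists ('D_(y - v) H v).
  near=> t.
  have t0 : 0 < t by near: t; exact: nbhs_right_gt.
  have t1 : t < 1 by near: t; exact: nbhs_right_lt.
  rewrite /= /GRing.scale/= ler_pdivlMl//.
  have t01 : 0 <= t <= 1 by rewrite (ltW t0) (ltW t1).
  have := hconc y v t y0 (ltW v0) t01.
  have -> : t * y + (1 - t) * v = t * (y - v) + v by lra.
  have yt : 0 < t * (y - v) + v by nra.
  rewrite hyE hH// [X in (_ <= X)%E]hH// -!EFinM -EFinD lee_fin; lra.
exists ('D_1 H v); last exact: le_h.
(* Strict growth from [v] to [v + 1] forces the slope to be positive. *)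
have := lt_le_trans (hincr v (v + 1) (ltW v0) _) (le_h (v + 1) _).
rewrite ltrDl ltr01 addr_ge0 ?ltW// => /(_ isT isT).
by rewrite hH// lte_fin addrAC subrr add0r mulr1 ltrDl.
Unshelve. all: by end_near. Qed.

Definition weight_primitive (R : realType) (g : nat -> R) (n : nat) : R :=
  \sum_(m < n) g m.

Lemma weight_primitive_ge0 (R : realType) (g : nat -> R) n :
  (forall m, 0 <= g m) -> 0 <= weight_primitive g n.
Proof. by move=> g0; apply: sumr_ge0. Qed.

(** Going up adds exactly g(n); going down removes g(n - 1), and the missing g(n) - g(n - 1) is at
    most [delta * g n] up to a constant. *)
Lemma weight_primitive_step (R : realType) (g : nat -> R) (delta : R) :
  weight_function g -> 0 < delta ->
  exists B : R, forall (n : nat) (a s : bool),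
    weight_primitive g (n + a - s) <=
    weight_primitive g n + (g n * (a%:R - s%:R) + delta * g n + B).
Proof.
move=> [g0 gincr glim] delta0.
have gW m n : (m <= n)%N -> g m <= g n.
  by rewrite leq_eqVlt => /orP[/eqP -> //|/gincr/ltW].
(* From [n0] on, the ratio of g to its increment is at least 1 / delta; below [n0] the increment is
   at most [g n0]. *)
have /cvgryPge/(_ delta^-1)[n0 _ hn0] := glim.
have gap n : g n.+1 - g n <= delta * g n.+1 + g n0.
  have [n0n|nn0] := leqP n0 n; last first.
    have := gW _ _ nn0; have := g0 n; have := mulr_ge0 (ltW delta0) (g0 n.+1); lra.
  have := hn0 n n0n; rewrite /= ler_pdivlMr ?subr_gt0 ?gincr//.
  rewrite mulrC ler_pdivrMr// => hgap.
  have := gW _ _ (leqnSn n); have := g0 n0; nra.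
exists (g 0%N + g n0) => n a s.
have d0 := mulr_ge0 (ltW delta0) (g0 n).
have := g0 0%N; have := g0 n0; case: a s => [] [] /=.
- by rewrite addnK; lra.
- by rewrite addn1 subn0 /weight_primitive big_ord_recr/=; lra.
(* At an empty queue the truncated subtraction leaves 0, and the summand [g 0] of the constant pays
   for [- g 0]. *)
- rewrite addn0; case: n d0 => [|n] d0.
    by rewrite sub0n /weight_primitive big_ord0; lra.
  by rewrite subn1 /weight_primitive big_ord_recr/=; have := gap n; lra.
- by rewrite addn0 subn0; lra.
Qed.

(** The inequality includes [n] outside [D], where the sum vanishes; a formal next state need not
    lie in [S]. *)
Lemma esum_eq_mul_le (R : realType) (I : choiceType) (D : set I) (n : I)
    (F : I -> R) : 0 <= F n ->
  (\esum_(y in D) ((y == n)%:R * F y)%:E <= (F n)%:E)%E.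
Proof.
move=> Fn0; have F0 y : (0 <= ((y == n)%:R * F y)%:E)%E.
  by rewrite lee_fin; case: eqP => [->|]; rewrite ?mul1r ?mul0r.
have [Dn|Dn] := pselect (D n).
  rewrite (esum_setD1 Dn)// eqxx mul1r esum1 ?adde0// => y [_ /= /eqP/negPf ->].
  by rewrite mul0r.
rewrite esum1 ?lee_fin// => y Dy; case: eqP => [yn|]; last by rewrite mul0r.
by case: Dn; rewrite -yn.
Qed.

(** * Averages over arrivals and services, and optimality of the service rates *)

Lemma mean_affine (R : comPzRingType) (A : finType) (N : nat)
    (q : A -> R) (f : A -> 'I_N -> R) (K : R) (w : 'I_N -> R) :
  \sum_x q x = 1 ->
  \sum_x q x * (K + \sum_i w i * f x i) = K + \sum_i w i * \sum_x q x * f x i.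
Proof.
move=> q1; under eq_bigr do rewrite mulrDr.
rewrite big_split/= -mulr_suml q1 mul1r; congr (_ + _).
under eq_bigr do rewrite mulr_sumr.
rewrite exchange_big/=; apply: eq_bigr => i _; rewrite mulr_sumr.
by apply: eq_bigr => x _; rewrite mulrCA.
Qed.

(** In the drift this replaces the increments by arrival rates minus service rates. *)
Lemma mean_affine_sub (R : comPzRingType) (A B : finType) (N : nat)
    (q : A -> R) (r : B -> R) (a : A -> 'I_N -> R) (b : B -> 'I_N -> R)
    (K : R) (w : 'I_N -> R) :
  \sum_x q x = 1 -> \sum_y r y = 1 ->
  \sum_x \sum_y r y * q x * (K + \sum_i w i * (a x i - b y i)) =
  K + \sum_i w i * (\sum_x q x * a x i - \sum_y r y * b y i).
Proof.
move=> q1 r1.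
transitivity (\sum_x q x * (K + \sum_i w i * (a x i - \sum_y r y * b y i))).
  apply: eq_bigr => x _; under eq_bigr do rewrite mulrAC.
  rewrite -mulr_suml mean_affine// mulrC; congr (_ * (_ + _)).
  apply: eq_bigr => i _; congr (_ * _).
  under eq_bigr do rewrite mulrBr.
  by rewrite sumrB -mulr_suml r1 mul1r.
rewrite mean_affine//; congr (_ + _); apply: eq_bigr => i _; congr (_ * _).
under eq_bigr do rewrite mulrBr.
by rewrite sumrB -mulr_suml q1 mul1r.
Qed.

(** The utility at [mu] may be -oo, but its tangent upper bound is finite; positivity of [nu] makes
    the utility at [nu] finite, so the two can be subtracted. *)
Lemma utility_argmax_descent (R : realType) (N : nat) (C : set 'rV[R]_N)
    (g : nat -> R) (h : R -> \bar R) (x : {ffun 'I_N -> nat})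
    (mu nu : 'rV[R]_N) (c : 'I_N -> R) :
  service_region C -> utility_function h -> (forall n, 0 <= g n) ->
  is_argmax C (utility g h x) mu -> C nu -> (forall i, 0 < nu ord0 i) ->
  (forall i y, 0 <= y ->
    (h y <= (fine (h (nu ord0 i)) + c i * (y - nu ord0 i))%:E)%E) ->
  \sum_i c i * g (x i) * (nu ord0 i - mu ord0 i) <= 0.
Proof.
move=> [C0 _ _] [hfin _ _ _ _] g0 [Cmu /(_ nu)] + Cnu nu0 hc => /(_ Cnu) le_u.
have : (utility g h x mu <= \sum_(i < N) (g (x i) *
    (fine (h (nu ord0 i)) + c i * (mu ord0 i - nu ord0 i)))%:E)%E.
  apply: lee_sum => i _; rewrite EFinM; apply: lee_wpmul2l; first by rewrite lee_fin.
  by apply: hc; exact: C0.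
move=> /(le_trans le_u).
rewrite /utility (eq_bigr (fun i => (g (x i) * fine (h (nu ord0 i)))%:E)); last first.
  by move=> i _; rewrite EFinM fineK// hfin.
rewrite !sumEFin lee_fin => le_s.
rewrite -subr_ge0 in le_s; rewrite -oppr_ge0 (le_trans le_s)// -sumrB -sumrN.
by apply: ler_sum => i _; rewrite le_eqVlt; apply/orP; left; apply/eqP; ring.
Qed.

Lemma bounded_states_seq (N M : nat) : exists l : seq {ffun 'I_N -> nat},
  forall x : {ffun 'I_N -> nat}, (forall i, (x i < M)%N) -> x \in l.
Proof.
exists [seq [ffun i => nat_of_ord (f i)] | f : {ffun 'I_N -> 'I_M}
         <- enum {ffun 'I_N -> 'I_M}] => x xM.
apply/mapP; exists [ffun i => Ordinal (xM i)]; first by rewrite mem_enum.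
by apply/ffunP => i; rewrite !ffunE.
Qed.

(** * The drift bound for the network *)

Theorem theorem1 (R : realType) (d : measure_display) (T : measurableType d)
    (P : probability T R) (N : nat)
    (* the queues, the arrivals and the service completions *)
    (X xi : nat -> 'I_N -> {RV P >-> nat})
    (eta : nat -> 'I_N -> {RV P >-> bool})
    (* the state space, the arrival rates, the conditional service laws *)
    (S : set {ffun 'I_N -> nat}) (lambda : 'rV[R]_N)
    (Q : {ffun 'I_N -> nat} -> {ffun 'I_N -> bool} -> R)
    (* the transition matrix of the chain *)
    (p : {ffun 'I_N -> nat} -> {ffun 'I_N -> nat} -> R)
    (C : set 'rV[R]_N) (h : R -> \bar R) (g : nat -> R)
    (model : network X xi eta S lambda Q)
    (chain : markov_chain S p P (fun k => vec (X k)))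
    (chain_irreducible : irreducible S p)
    (hC : service_region C) (hh : utility_function h) (hg : weight_function g)
    (g_infty : g n @[n --> \oo] --> +oo)
    (psi0 : forall x i, S x -> x i = 0%N -> service_rate Q x ord0 i = 0)
    (psi_max : forall x, S x -> is_argmax C (utility g h x) (service_rate Q x))
    (arrivals_bernoulli : forall k i, bernoulli_variable (xi k i))
    (stable : exists nu : 'rV[R]_N, C nu /\
                forall i, lambda ord0 i < nu ord0 i) :
  positive_recurrent S p.
Proof.
have [g0 _ _] := hg.
have [nu [Cnu lt_nu]] := stable.
have pmf0 := arrival_pmf_ge0 xi.
have pmf1 := sum_arrival_pmf arrivals_bernoulli.
have pmfE := arrival_pmf_mean model arrivals_bernoulli.
have nu0 i : 0 < nu ord0 i.
  apply: le_lt_trans (lt_nu i); rewrite -pmfE.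
  by apply: sumr_ge0 => a _; rewrite mulr_ge0.
have /choice[c hc] : forall i, exists c : R, 0 < c /\
    forall y, 0 <= y -> (h y <= (fine (h (nu ord0 i)) + c * (y - nu ord0 i))%:E)%E.
  by move=> i; have [c c0 hc] := utility_supergradient hh (nu0 i); exists c.
have c0 i : 0 < c i by case: (hc i).
(* Half of the slack absorbs the error of [weight_primitive_step]; the other half is the negative
   drift. *)
pose delta i := (nu ord0 i - lambda ord0 i) / 2.
have delta0 i : 0 < delta i by rewrite divr_gt0// subr_gt0.
have /choice[B hB] := fun i => weight_primitive_step hg (delta0 i).
pose V (x : {ffun 'I_N -> nat}) := \sum_i c i * weight_primitive g (x i).
have V0 x : 0 <= V x.
  by apply: sumr_ge0 => i _; rewrite mulr_ge0 ?(ltW (c0 i))// weight_primitive_ge0.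
pose K := \sum_i c i * `|B i|.
have K0 : 0 <= K by apply: sumr_ge0 => i _; rewrite mulr_ge0// ltW.
(* A single queue of length at least [M] contributes at least [K + 1] to the negative drift. *)
have [M _ hM] : \forall n \near \oo, forall i, K + 1 <= c i * delta i * g n.
  apply: filter_forall => i.
  move/cvgryPge : g_infty => /(_ ((K + 1) / (c i * delta i))).
  have cd0 : 0 < c i * delta i by exact: mulr_gt0.
  by apply: filterS => n; rewrite (ler_pdivrMr _ _ cd0) mulrC.
have [l hl] := bounded_states_seq N M.
apply: (@foster_lyapunov _ _ S p V (K + 1) l) => //.
- by case: chain.
- by rewrite addr_ge0.
move=> x Sx.
have [Q0 Q1] := service_law model Sx.
have drift : (\esum_(y in S) (p x y * V y)%:E <=
    (V x + (K - \sum_i c i * delta i * g (x i)))%:E)%E.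
  (* [p] is replaced by its upper bound, the finite sum over pairs moves outside, and the sum over
     [y] collapses at the next state. *)
  apply: (@le_trans _ _ (\esum_(y in S) \sum_(as_ : _ * _)
      ((Q x as_.2 * arrival_pmf xi as_.1)%:E *
       ((y == next_state x as_.1 as_.2)%:R * V y)%:E))%E).
    apply: le_esum => y Sy.
    apply: (@le_trans _ _ ((\sum_a \sum_s (y == next_state x a s)%:R *
      (Q x s * arrival_pmf xi a)) * V y)%:E).
      rewrite lee_fin; apply: ler_wpM2r; first exact: V0.
      exact: (transition_le model chain chain_irreducible arrivals_bernoulli Sx Sy).
    rewrite pair_big/= mulr_suml -sumEFin; apply: lee_sum => -[a s] _ /=.
    by rewrite -EFinM lee_fin mulrAC mulrC mulrA.
  rewrite esum_sum; last first.
    by move=> y as_ Sy _; rewrite -EFinM lee_fin !mulr_ge0.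
  apply: (@le_trans _ _ (\sum_(as_ : {ffun 'I_N -> bool} * {ffun 'I_N -> bool})
      (Q x as_.2 * arrival_pmf xi as_.1 * V (next_state x as_.1 as_.2))%:E)%E).
    apply: lee_sum => -[a s] _ /=; rewrite [leRHS]EFinM.
    apply: (le_trans (le_esumZl _ _)); first by rewrite lee_fin mulr_ge0.
      by move=> y _; rewrite lee_fin mulr_ge0.
    apply: lee_wpmul2l; first by rewrite lee_fin mulr_ge0.
    exact: esum_eq_mul_le.
  rewrite sumEFin lee_fin.
  rewrite -(pair_big predT predT (fun a s =>
    Q x s * arrival_pmf xi a * V (next_state x a s)))/=.
  (* [D] gathers the errors of all queues; the rest is affine in [a] and [s], so only their means
     matter. *)
  pose D := \sum_i c i * (delta i * g (x i) + B i).
  apply: (@le_trans _ _ (\sum_a \sum_s Q x s * arrival_pmf xi a *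
     (V x + D + \sum_i c i * g (x i) * ((a i)%:R - (s i)%:R)))).
    apply: ler_sum => a _; apply: ler_sum => s _.
    apply: ler_wpM2l; first by rewrite mulr_ge0.
    rewrite /V /D -!big_split/=; apply: ler_sum => i _; rewrite ffunE.
    have := ler_wpM2l (ltW (c0 i)) (hB i (x i) (a i) (s i)); lra.
  rewrite (mean_affine_sub (fun (a : {ffun 'I_N -> bool}) i => (a i)%:R)
    (fun (s : {ffun 'I_N -> bool}) i => (s i)%:R))//.
  rewrite -addrA lerD2l.
  have desc := utility_argmax_descent hC hh g0 (psi_max x Sx) Cnu nu0
    (fun i => (hc i).2).
  (* In lambda - psi = (nu - psi) - 2 delta, the first part contributes at most 0 by optimality, and
     one delta of the second is spent on [D]. *)
  rewrite -[leRHS]addr0 -lerBlDl; apply: le_trans desc; rewrite lerBlDl.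
  rewrite /D /K -sumrB -!big_split/=; apply: ler_sum => i _.
  rewrite pmfE.
  have -> : \sum_s Q x s * (s i)%:R = service_rate Q x ord0 i by rewrite mxE.
  have := ler_wpM2l (ltW (c0 i)) (ler_norm (B i)).
  have : delta i * 2 = nu ord0 i - lambda ord0 i by rewrite /delta; lra.
  nra.
apply: (le_trans (leeD2r 1 drift)); rewrite -EFinD lee_fin -addrA lerD2l.
have s0 i : 0 <= c i * delta i * g (x i).
  by apply: mulr_ge0; rewrite ?g0 ?(ltW (mulr_gt0 (c0 i) (delta0 i))).
(* Inside the box the allowance [K + 1] pays; outside, one long queue suffices because the other
   terms are nonnegative. *)
have [xM|] := pselect (forall i, (x i < M)%N).
  rewrite hl// mulr1; have : 0 <= \sum_i c i * delta i * g (x i) by exact: sumr_ge0.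
  by lra.
move=> /existsNP[i /negP]; rewrite -leqNgt => Mx.
have : K + 1 <= \sum_i c i * delta i * g (x i).
  rewrite (bigD1 i)//= (le_trans (hM _ Mx i))// lerDl.
  by apply: sumr_ge0 => j _.
have : 0 <= (K + 1) * (x \in l)%:R by rewrite mulr_ge0// addr_ge0.
by lra.
Qed.
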